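(* For every integer $n \ge 7$ and every integer $p \ge 3$, no player has a winning strategy in the $p$-player Tribonacci game starting from $n$ copies of $T_1 = 1$.
   Context: The Tribonacci numbers are defined by $T_1 = 1$, $T_2 = 2$, $T_3 = 4$ and $T_{i+1} = T_i + T_{i-1} + T_{i-2}$ for $i \ge 3$. The $p$-player Tribonacci game on $n$: a position is a finite unordered list (multiset) of Tribonacci numbers; the initial position consists of $n$ copies of $T_1$. Players $1, 2, \dots, p$ take turns in cyclic order, starting with Player $1$ (Player $1$ moves again after Player $p$). On each turn the player whose turn it is makes one of the following moves, provided the terms on the left are present in the list (with the required multiplicity); they are removed and replaced by the terms on the right: 1. $T_{i-2} \wedge T_{i-1} \wedge T_i \to T_{i+1}$ for $i \ge 3$; 2. $T_1 \wedge T_1 \wedge T_2 \to T_3$; 3. $T_1 \wedge T_1 \to T_2$; $T_2 \wedge T_2 \to T_3$; $T_3 \wedge T_3 \to T_4 \wedge T_1$; and $T_i \wedge T_i \to T_{i+1} \wedge T_{i-3}$ for $i \ge 4$. The game ends when no move is available, and the player who made the final move wins. Player $m$ has a winning strategy if Player $m$ can guarantee making the final move no matter what moves the other $p-1$ players make. *)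

(* Defs.v *)
From mathcomp Require Import all_boot finmap multiset.

Set Implicit Arguments.
Unset Strict Implicit.
Unset Printing Implicit Defensive.

Local Open Scope mset_scope.
Local Open Scope nat_scope.

(* The sequence starts at index 1; the value at index 0 is a dummy that no
   rule of the game uses. *)
Fixpoint trib (i : nat) : nat :=
  match i with
  | 0 => 0
  | 1 => 1
  | 2 => 2
  | 3 => 4
  | ((k.+1 as c).+1 as b).+1 => trib b + trib c + trib k
  end.

Definition position := {mset nat}.

Definition initial (n : nat) : position := msetn n (trib 1).

(* [rule l r]: the terms of [l] may be replaced by those of [r]. *)
Inductive rule : position -> position -> Prop :=
| rule_add3 i : 3 <= i ->
    rule [mset trib (i - 2); trib (i - 1); trib i] [mset trib i.+1]
| rule_112 : rule [mset trib 1; trib 1; trib 2] [mset trib 3]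
| rule_11 : rule [mset trib 1; trib 1] [mset trib 2]
| rule_22 : rule [mset trib 2; trib 2] [mset trib 3]
| rule_33 : rule [mset trib 3; trib 3] [mset trib 4; trib 1]
| rule_double i : 4 <= i ->
    rule [mset trib i; trib i] [mset trib i.+1; trib (i - 3)].

Inductive move (s : position) : position -> Prop :=
| move_rule l r : rule l r -> l `<=` s -> move s ((s `\` l) `+` r).

Definition ended (s : position) : Prop := forall s', ~ move s s'.

(* The player, in {1, ..., p}, who moves after [k] moves have been made. *)
Definition player_to_move (p k : nat) : nat := (k %% p).+1.

(* A strategy prescribes the next position from the list of all earlier
   positions, oldest first, and the current position. *)
Definition strategy := seq position -> position -> position.

(* The number of moves already made is the number of earlier positions. *)
Definition legal_strategy (p m : nat) (sigma : strategy) : Prop :=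
  forall h s, player_to_move p (size h) = m -> ~ ended s -> move s (sigma h s).

(* [conforms p n m sigma h s]: starting from [n] copies of [trib 1], the
   positions [rcons h s] can be visited when Player [m] follows [sigma] and the
   other players make arbitrary moves. *)
Inductive conforms (p n m : nat) (sigma : strategy) :
  seq position -> position -> Prop :=
| conforms_start : conforms p n m sigma [::] (initial n)
| conforms_step h s s' :
    conforms p n m sigma h s -> move s s' ->
    (player_to_move p (size h) = m -> s' = sigma h s) ->
    conforms p n m sigma (rcons h s) s'.

Definition made_final_move (p m : nat) (h : seq position) : Prop :=
  0 < size h /\ player_to_move p (size h).-1 = m.

(* No conforming play goes on forever, and every conforming play that has
   ended was ended by Player [m]. *)
Definition winning_strategy (p n m : nat) (sigma : strategy) : Prop :=
  [/\ legal_strategy p m sigma,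
      ~ (exists f : nat -> position,
           forall k, conforms p n m sigma (mkseq f k) (f k))
    & forall h s, conforms p n m sigma h s -> ended s -> made_final_move p m h].

Definition has_winning_strategy (p n m : nat) : Prop :=
  exists sigma : strategy, winning_strategy p n m sigma.

(* Main.v *)
Require Import Defs.
From mathcomp Require Import all_boot.
From mathcomp Require Import finmap multiset zify.
From Stdlib Require Import Classical ClassicalEpsilon.

Set Implicit Arguments.
Unset Strict Implicit.
Unset Printing Implicit Defensive.

Local Open Scope mset_scope.
Local Open Scope nat_scope.

(** The opponents of Player [m] defeat her by stealing her strategy.  Call
    [forced_win p m k s] the assertion that Player [m] can force the final move
    from [s] when [k] moves have been made; a winning strategy gives it for
    [k = 0] and the initial position, by [winning_strategy_forced].

    A position [s] determines [k] modulo [p]: this is [forced_win_turn_unique].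
    Indeed, if Player [m] could force the final move both after [k] and after
    [l] moves, then in a game begun at [s] two seats, differing by [l - k]
    modulo [p], could each force the final move; playing the two strategies
    against each other would give the final move to both seats.

    Now [1, 1, 2] becomes [4] in a single move, or in two moves through [2, 2].
    So whenever two consecutive opponents face a position containing [1, 1, 2],
    they can reach the same position after different numbers of moves, and
    Player [m] has no forced win there ([no_forced_win_steal_112]).  Write [1^a]
    for [a] copies of [1].  The first move leads to [1^(n-2), 2], where this
    applies at once unless [m] is [2] or [3].  For [m = 3], Player 2 moves to
    [1^(n-4), 4], whose only successor is [1^(n-6), 2, 4].  For [m = 2], moving
    to [1^(n-4), 2, 2] allows the steal immediately, and otherwise
    [1^(n-6), 2, 4] is reached again.  In that position the steal applies
    unless [n = 7], where the opponent to move ends the game by playing to [7],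
    or [p = 3] and [m = 2], where only one opponent moves before Player 2 does;
    [no_forced_win_three_players_124] settles this last case by comparing
    longer lines of play. *)

(** * Forced wins *)

(** Unlike a strategy, a forced win does not depend on the history.  Being
    inductive, it carries the termination of the play, so that two forced wins
    can be played against each other by induction. *)
Inductive forced_win (p m : nat) : nat -> position -> Prop :=
| forced_own k s s' : player_to_move p k = m -> move s s' ->
    forced_win p m k.+1 s' -> forced_win p m k s
| forced_other k s : player_to_move p k <> m -> ~ ended s ->
    (forall s', move s s' -> forced_win p m k.+1 s') -> forced_win p m k s
| forced_ended k s : ended s -> 0 < k -> player_to_move p k.-1 = m ->
    forced_win p m k s.

Lemma not_endedP s : ~ ended s -> exists s', move s s'.
Proof.
move=> nes; apply: NNPP => nex; apply: nes => s' ss'.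
by apply: nex; exists s'.
Qed.

(** Otherwise Player [m] follows her strategy while the opponents keep moving
    to positions without a forced win.  Such a play never ends, since a
    conforming play that ends is itself a forced win, and a winning strategy
    admits no infinite conforming play. *)
Lemma winning_strategy_forced p n m sigma :
  winning_strategy p n m sigma -> forced_win p m 0 (initial n).
Proof.
move=> [legal finite final]; apply: NNPP => not_forced.
pose bad (hs : seq position * position) :=
  conforms p n m sigma hs.1 hs.2 /\ ~ forced_win p m (size hs.1) hs.2.
have step hs : bad hs -> exists s', bad (rcons hs.1 hs.2, s').
  case: hs => h s [/= conf nwin].
  have nes : ~ ended s.
    move=> es; have [h_gt0 last_m] := final _ _ conf es.
    by apply: nwin; apply: forced_ended.
  case: (classic (player_to_move p (size h) = m)) => turn.
    exists (sigma h s); split=> /=.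
      by apply: conforms_step => //; apply: legal.
    rewrite size_rcons => win; apply: nwin.
    by apply: forced_own win => //; apply: legal.
  apply: NNPP => no_bad; apply: nwin; apply: forced_other => // s' ss'.
  apply: NNPP => nwin'; apply: no_bad; exists s'.
  by split; [exact: conforms_step|rewrite /= size_rcons].
pose next hs := (rcons hs.1 hs.2,
  epsilon (inhabits hs.2) (fun s' => bad (rcons hs.1 hs.2, s'))).
pose play k := iter k next ([::], initial n).
have bad_play k : bad (play k).
  elim: k => [|k /step /(epsilon_spec (inhabits (play k).2))] //.
  by split=> //; apply: conforms_start.
have playE k : (play k).1 = mkseq (fun j => (play j).2) k.
  by elim: k => [|k IHk] //; rewrite mkseqS -IHk.
apply: finite; exists (fun k => (play k).2) => k; rewrite -playE.
by case: (bad_play k).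
Qed.

Lemma forced_win_own p m k s : forced_win p m k s -> player_to_move p k = m ->
  ~ ended s -> exists2 s', move s s' & forced_win p m k.+1 s'.
Proof. by case=> [{}k {}s s' _ ? ?|//|//]; exists s'. Qed.

Lemma forced_win_other p m k s s' : forced_win p m k s ->
  player_to_move p k <> m -> move s s' -> forced_win p m k.+1 s'.
Proof.
case=> [//|{}k {}s _ _ win _ ss'|{}k {}s es _ _ _ ss']; first exact: win.
by case: (es s').
Qed.

Lemma forced_win_ended p m k s : forced_win p m k s -> ended s ->
  0 < k /\ player_to_move p k.-1 = m.
Proof. by case=> [{}k {}s s' _ ss' _ es|//|//]; case: (es s'). Qed.

(** At each step at least one of the two forced wins prescribes a move that the
    other has to answer, unless Player [m] is to move in both; the final move
    then settles the matter, as it is made by the same player in both. *)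
Lemma forced_win_turn_unique p m k l s :
  forced_win p m k s -> forced_win p m l s -> k = l %[mod p].
Proof.
have succ_inj i j : i.+1 = j.+1 %[mod p] -> i = j %[mod p].
  by move/eqP; rewrite -(addn1 i) -(addn1 j) eqn_modDr => /eqP.
move=> win; elim: win l => {k s} [k s s' turn ss' _ IH|k s turn nes _ IH
  |k s es k_gt0 turn] l win'.
- case: (classic (player_to_move p l = m)) => [|turn'].
    by rewrite -turn => -[->].
  exact/succ_inj/IH/(forced_win_other win').
- case: (classic (player_to_move p l = m)) => turn'.
    have [s' ss' win_s'] := forced_win_own win' turn' nes.
    exact/succ_inj/(IH s').
  have [s' ss'] := not_endedP nes.
  exact/succ_inj/(IH s' ss')/(forced_win_other win').
- have [l_gt0] := forced_win_ended win' es.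
  rewrite -turn => -[] eq_pred.
  by rewrite -(prednK k_gt0) -(prednK l_gt0) -(addn1 k.-1) -(addn1 l.-1)
    -modnDml -eq_pred modnDml.
Qed.

(** The opponents reach [t] after one move or after two, as they please, and
    these counts are not congruent modulo [p]. *)
Lemma no_forced_win_steal p m k s t u : 1 < p ->
  player_to_move p k <> m -> player_to_move p k.+1 <> m ->
  move s t -> move s u -> move u t -> ~ forced_win p m k s.
Proof.
move=> p_gt1 turn turn' st su ut win.
have win_t := forced_win_other win turn st.
have win_t' := forced_win_other (forced_win_other win turn su) turn' ut.
have /eqP := forced_win_turn_unique win_t win_t'.
rewrite -[in X in _ == X]addn1 -[in X in X == _](addn0 k.+1) eqn_modDl.
by rewrite mod0n modn_small.
Qed.

(** * The early game *)

Definition pos a b c d : position :=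
  msetn a 1 `+` msetn b 2 `+` msetn c 4 `+` msetn d 7.

(** The moves that involve no terms but [1], [2], [4] and [7].  The source is
    indexed by its multiplicities so that inversion lists the moves from it. *)
Inductive early_move : nat -> nat -> nat -> nat -> position -> Prop :=
| early_124 a b c d : early_move a.+1 b.+1 c.+1 d (pos a b c d.+1)
| early_112 a b c d : early_move a.+2 b.+1 c d (pos a b c.+1 d)
| early_11 a b c d : early_move a.+2 b c d (pos a b.+1 c d)
| early_22 a b c d : early_move a b.+2 c d (pos a b c.+1 d)
| early_44 a b c d : early_move a b c.+2 d (pos a.+1 b c d.+1).

Lemma pos_initial n : initial n = pos n 0 0 0.
Proof. by apply/msetP => x; rewrite !msetE2 !msetnE !if_same !addn0. Qed.

Lemma posE a b c d x : pos a b c d x =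
  (if x == 1 then a else 0) + (if x == 2 then b else 0) +
  (if x == 4 then c else 0) + (if x == 7 then d else 0).
Proof. by rewrite !msetE2 !msetnE. Qed.

Lemma trib4 : trib 4 = 7. Proof. by []. Qed.

(** Positions are compared by counting each term [x]; only [1], [2], [4] and
    [7] can have a nonzero count. *)
Ltac compare_counts x :=
  rewrite ?posE ?msetE2 ?msetnE ?trib4 /=;
  have [xE|_] := eqVneq x 1; [subst x|
  have [xE|_] := eqVneq x 2; [subst x|
  have [xE|_] := eqVneq x 4; [subst x|
  have [xE|_] := eqVneq x 7; [subst x|]]]]; rewrite /=; lia.

Lemma early_moveP a b c d s' : early_move a b c d s' -> move (pos a b c d) s'.
Proof.
have mk (s l r t : position) : rule l r -> (forall x : nat, l x <= s x) ->
    (forall x : nat, s x - l x + r x = t x) -> move s t.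
  move=> lr /msubsetP ls st; rewrite (_ : t = (s `\` l) `+` r); first exact: move_rule.
  by apply/msetP => x; rewrite !msetE2 st.
case=> {a b c d s'} a b c d; [apply: mk (@rule_add3 3 isT) _ _
  |apply: mk rule_112 _ _|apply: mk rule_11 _ _|apply: mk rule_22 _ _
  |apply: mk rule_33 _ _] => x;
compare_counts x.
Qed.

Lemma trib_ge13 i : 5 <= i -> 13 <= trib i.
Proof.
elim: i => [|[|[|[|[|[|i]]]]] IH] // _.
by apply: leq_trans (IH isT) _; rewrite [leqRHS]/= -addnA leq_addr.
Qed.

Lemma pos_trib_ge5 a b c d i : 5 <= i -> pos a b c d (trib i) = 0.
Proof.
by move=> /trib_ge13; move: (trib i) => x x_ge13; compare_counts x.
Qed.

(** Any other move takes [2, 4, 7] or [7, 7], which the two hypotheses exclude,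
    or a term that is at least [13]. *)
Lemma move_early a b c d s' : d <= 1 -> c * d = 0 ->
  move (pos a b c d) s' -> early_move a b c d s'.
Proof.
move=> d_le1 cd0.
have eq_early (t s : position) : early_move a b c d t -> (forall x : nat, s x = t x) ->
    early_move a b c d s.
  by move=> mt /msetP ->.
case=> l r lr /msubsetP; case: lr => {l r} [i i_ge3|||||i i_ge4] lP.
- have i_le4 : i <= 4.
    rewrite leqNgt; apply/negP => /(pos_trib_ge5 a b c d) pos0.
    by have := lP (trib i); rewrite pos0 !msetE2 !msetnE eqxx addn1.
  have [i3|i4] : i = 3 \/ i = 4 by lia.
    subst i.
    have := conj (lP 1) (conj (lP 2) (lP 4)); rewrite !posE !msetE2 !msetnE /= => lP'.
    case: a b c eq_early {cd0 lP} lP' => [|a] [|b] [|c] eq_early lP'; try lia.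
    apply: eq_early (early_124 _ _ _ _) _ => x.
    by compare_counts x.
  by have := conj (lP 4) (lP 7); rewrite i4 !posE !msetE2 !msetnE /=; nia.
- have := conj (lP 1) (lP 2); rewrite !posE !msetE2 !msetnE /= => lP'.
  case: a b eq_early {lP} lP' => [|[|a]] [|b] eq_early lP'; try lia.
  apply: eq_early (early_112 _ _ _ _) _ => x.
  by compare_counts x.
- have := lP 1; rewrite !posE !msetE2 !msetnE /= => lP'.
  case: a eq_early {lP} lP' => [|[|a]] eq_early lP'; try lia.
  apply: eq_early (early_11 _ _ _ _) _ => x.
  by compare_counts x.
- have := lP 2; rewrite !posE !msetE2 !msetnE /= => lP'.
  case: b eq_early {lP} lP' => [|[|b]] eq_early lP'; try lia.
  apply: eq_early (early_22 _ _ _ _) _ => x.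
  by compare_counts x.
- have := lP 4; rewrite !posE !msetE2 !msetnE /= => lP'.
  case: c eq_early {cd0 lP} lP' => [|[|c]] eq_early lP'; try lia.
  apply: eq_early (early_44 _ _ _ _) _ => x.
  by compare_counts x.
- have i4 : i = 4.
    suff: i <= 4 by lia.
    rewrite leqNgt; apply/negP => /(pos_trib_ge5 a b c d) pos0.
    by have := lP (trib i); rewrite pos0 !msetE2 !msetnE eqxx addn1.
  by have := lP 7; rewrite i4 !posE !msetE2 !msetnE /=; lia.
Qed.

(** * Play from [1, ..., 1, 2, 4] and the theorem *)

Lemma no_forced_win_steal_112 p m k a b c d : 1 < p ->
  player_to_move p k <> m -> player_to_move p k.+1 <> m ->
  ~ forced_win p m k (pos a.+2 b.+1 c d).
Proof.
move=> p_gt1 turn turn'.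
by apply: (no_forced_win_steal p_gt1 turn turn'); apply: early_moveP;
  [apply: early_112|apply: early_11|apply: early_22].
Qed.

Lemma ended_7 : ended (pos 0 0 0 1).
Proof.
by move=> s' /(@move_early 0 0 0 1 s' isT erefl) mv; inversion mv.
Qed.

Lemma nended_early a b c d s' : early_move a b c d s' -> ~ ended (pos a b c d).
Proof. by move=> /early_moveP mv /(_ s'). Qed.

Lemma forced_win_own_early p m k a b c d s0 : forced_win p m k (pos a b c d) ->
  player_to_move p k = m -> d <= 1 -> c * d = 0 -> early_move a b c d s0 ->
  exists2 s', early_move a b c d s' & forced_win p m k.+1 s'.
Proof.
move=> win turn d_le1 cd0 /nended_early nes.
have [s' /(move_early d_le1 cd0) mv win'] := forced_win_own win turn nes.
by exists s'.
Qed.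

Lemma forced_win_other_early p m k a b c d s' : forced_win p m k (pos a b c d) ->
  player_to_move p k <> m -> early_move a b c d s' -> forced_win p m k.+1 s'.
Proof. by move=> win turn /early_moveP; apply: forced_win_other. Qed.

(** The opponent to move ends the game by playing to [7]. *)
Lemma no_forced_win_124 p m k : player_to_move p k <> m ->
  ~ forced_win p m k (pos 1 1 1 0).
Proof.
move=> turn win.
have win7 := forced_win_other_early win turn (early_124 0 0 0 0).
by have [_] := forced_win_ended win7 ended_7.
Qed.

(** Player 1 may move to [1^(k+1), 7] or to [1^k, 4, 4].  From the latter,
    Player 2 cannot afford to move to [1^(k+1), 7], one move later than
    Player 1 might have done.  His only other move, possible when [2 <= k], is
    to [1^(k-2), 2, 4, 4], from where Player 3 moves to [1^(k-1), 2, 7].  But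
    this is the only successor of [1^(k+1), 7], hence a forced win one move
    earlier as well. *)
Lemma no_forced_win_three_players_124 k : ~ forced_win 3 2 3 (pos k.+2 1 1 0).
Proof.
move=> win.
have win7 : forced_win 3 2 4 (pos k.+1 0 0 1).
  by apply: (forced_win_other_early win) => //; apply: early_124.
have win44 : forced_win 3 2 4 (pos k 0 2 0).
  by apply: (forced_win_other_early win) => //; apply: early_112.
have [s' mv win'] := forced_win_own_early win44 erefl isT erefl (early_44 _ _ _ _).
inversion mv; subst; last by have := forced_win_turn_unique win7 win'.
have win27 : forced_win 3 2 6 (pos a.+1 1 0 1).
  by apply: (forced_win_other_early win') => //; apply: early_44.
have [t mvt wint] := forced_win_own_early win7 erefl isT erefl (early_11 _ _ _ _).
inversion mvt; subst.
by have := forced_win_turn_unique win27 wint.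
Qed.

Theorem theorem1p5 (n p : nat) (hn : 7 <= n) (hp : 3 <= p) (m : nat)
    (hm : 1 <= m <= p) :
  ~ has_winning_strategy p n m.
Proof.
case=> sigma /winning_strategy_forced.
case: n hn => [|[|[|[|[|[|[|j]]]]]]] // _; rewrite pos_initial => win.
have p_gt1 : 1 < p by apply: ltnW.
have turn k : k < p -> player_to_move p k = k.+1.
  by move=> kp; rewrite /player_to_move modn_small.
have turn0 : player_to_move p 0 = 1 by apply: turn; lia.
have turn1 : player_to_move p 1 = 2 by apply: turn.
have turn2 : player_to_move p 2 = 3 by apply: turn.
have turn3 : p = 3 /\ player_to_move p 3 = 1 \/ 3 < p /\ player_to_move p 3 = 4.
  have [p_gt3|p_le3] := ltnP 3 p; [right; split=> //; exact: turn|left].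
  by have -> : p = 3 by lia.
have turn4 : player_to_move p 4 <= 2 \/ player_to_move p 4 = 5.
  have [p_gt4|p_le4] := ltnP 4 p; [right; exact: turn|left].
  by have [->|->] : p = 3 \/ p = 4 by lia.
have win1 : forced_win p m 1 (pos j.+4.+1 1 0 0).
  case: (eqVneq m 1) => [m1|m_neq1].
    have turn0m : player_to_move p 0 = m by lia.
    have [s' mv win'] := forced_win_own_early win turn0m isT erefl (early_11 _ _ _ _).
    by inversion mv; subst.
  by apply: (forced_win_other_early win); [lia|exact: early_11].
have [m2|[m3|m_neq]] : m = 2 \/ m = 3 \/ (m <> 2 /\ m <> 3) by lia.
(* Player 2 chooses between [1^(j+3), 2, 2] and [1^(j+3), 4]. *)
- have turn1m : player_to_move p 1 = m by lia.
  have [s' mv win2] := forced_win_own_early win1 turn1m isT erefl (early_11 _ _ _ _).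
  inversion mv; subst.
    have win3 := forced_win_other_early win2 ltac:(lia) (early_11 _ _ _ _).
    case: j win3 {win win1 mv win2} => [|j] win3.
      by apply: (no_forced_win_124 _ win3); lia.
    case: turn3 => [[p3 _]|[p_gt3 turn3]].
      by rewrite p3 in win3; apply: no_forced_win_three_players_124 win3.
    apply: (no_forced_win_steal_112 p_gt1 _ _ win3); [lia|].
    have [p_gt4|p_le4] := ltnP 4 p; first by rewrite turn.
    by have -> : p = 4 by lia.
  by apply: (no_forced_win_steal_112 p_gt1 _ _ win2); lia.
- have win2 := forced_win_other_early win1 ltac:(lia) (early_112 _ _ _ _).
  have turn2m : player_to_move p 2 = m by lia.
  have [s' mv win3] := forced_win_own_early win2 turn2m isT erefl (early_11 _ _ _ _).
  inversion mv; subst.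
  case: j win3 {win win1 mv win2} => [|j] win3.
    by apply: (no_forced_win_124 _ win3); lia.
  by apply: (no_forced_win_steal_112 p_gt1 _ _ win3); lia.
- by apply: (no_forced_win_steal_112 p_gt1 _ _ win1); lia.
Qed.
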